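(* Let $(E,\kappa)$ and $(B,\lambda)$ be connected digital images and let $p:(E,\kappa)\to(B,\lambda)$ be a $(\kappa,\lambda)$-continuous surjection. Then $p$ is a digital $(\kappa,\lambda)$-covering map if and only if $p$ is a local $(\kappa,\lambda)$-isomorphism.
   Context: A digital image $(X,\kappa)$ is a set $X\subseteq\mathbb{Z}^n$ (for some $n$) with an adjacency relation $\kappa$ (a symmetric, irreflexive relation) on its points. $X$ is connected if any two distinct points are joined by a finite sequence of points of $X$ with consecutive ones $\kappa$-adjacent. A function $f:(X,\kappa)\to(Y,\lambda)$ is $(\kappa,\lambda)$-continuous if whenever $x,x'$ are $\kappa$-adjacent, either $f(x)=f(x')$ or $f(x),f(x')$ are $\lambda$-adjacent. It is a $(\kappa,\lambda)$-isomorphism if it is a continuous bijection with $(\lambda,\kappa)$-continuous inverse (subsets carry the restricted adjacency). $N_\kappa(x,1)$ is the set consisting of $x$ and all points of $X$ that are $\kappa$-adjacent to $x$. A $(\kappa,\lambda)$-continuous map $h:X\to Y$ is a local $(\kappa,\lambda)$-isomorphism if for every $x\in X$ the restriction $h|_{N_\kappa(x,1)}$ is a $(\kappa,\lambda)$-isomorphism onto $N_\lambda(h(x),1)$. A $(\kappa,\lambda)$-continuous surjection $p:E\to B$ is a digital $(\kappa,\lambda)$-covering map if for each $b\in B$ there is an index set $M$ and points $e_i\in p^{-1}(b)$ ($i\in M$) such that: (1) $p^{-1}(N_\lambda(b,1))=\bigcup_{i\in M}N_\kappa(e_i,1)$; (2) $N_\kappa(e_i,1)\cap N_\kappa(e_j,1)=\emptyset$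 for $i\neq j$ in $M$; (3) for every $i\in M$ the restriction $p|_{N_\kappa(e_i,1)}:N_\kappa(e_i,1)\to N_\lambda(b,1)$ is a $(\kappa,\lambda)$-isomorphism. *)

(* Defs.v *)
From mathcomp Require Import all_boot all_algebra.
From mathcomp Require Import classical_sets functions.

Set Implicit Arguments.
Unset Strict Implicit.
Unset Printing Implicit Defensive.

Local Open Scope classical_set_scope.

(* The relation [adj] is only meaningful on points of [points]: its values
   elsewhere are unconstrained and no definition below depends on them. *)
Record digital_image (n : nat) := DigitalImage {
  points :> set 'rV[int]_n;
  adj : 'rV[int]_n -> 'rV[int]_n -> Prop;
  adj_sym : forall x y, points x -> points y -> adj x y -> adj y x;
  adj_irr : forall x, points x -> ~ adj x x }.

Section Subimage.
Variables (n : nat) (X : digital_image n) (A : set 'rV[int]_n).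

Fact subimage_sym x y : (X `&` A) x -> (X `&` A) y -> adj X x y -> adj X y x.
Proof. by move=> [Xx _] [Xy _]; exact: adj_sym. Qed.

Fact subimage_irr x : (X `&` A) x -> ~ adj X x x.
Proof. by move=> [Xx _]; exact: adj_irr. Qed.

Definition subimage : digital_image n :=
  DigitalImage subimage_sym subimage_irr.

End Subimage.

Definition connected_image n (X : digital_image n) : Prop :=
  forall x y, points X x -> points X y -> x <> y ->
  exists (k : nat) (c : nat -> 'rV[int]_n),
    [/\ c 0 = x, c k = y,
        forall i, i <= k -> points X (c i)
      & forall i, i < k -> adj X (c i) (c i.+1)].

(* A map X -> Y is represented by a function on the ambient lattice sending
   X into Y; its values outside X are irrelevant. *)
Definition digital_continuous m n (X : digital_image m) (Y : digital_image n)
    (f : 'rV[int]_m -> 'rV[int]_n) : Prop :=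
  set_fun X Y f /\
  forall x x', points X x -> points X x' -> adj X x x' ->
  f x = f x' \/ adj Y (f x) (f x').

Definition digital_isomorphism m n (X : digital_image m) (Y : digital_image n)
    (f : 'rV[int]_m -> 'rV[int]_n) : Prop :=
  [/\ set_bij X Y f,
      digital_continuous X Y f
    & exists g : 'rV[int]_n -> 'rV[int]_m,
        [/\ forall x, points X x -> g (f x) = x,
            forall y, points Y y -> f (g y) = y
          & digital_continuous Y X g]].

Definition nbhd1 n (X : digital_image n) (x : 'rV[int]_n) : set 'rV[int]_n :=
  [set y | y = x \/ points X y /\ adj X x y].

Definition nbhd1_isomorphism m n (X : digital_image m) (Y : digital_image n)
    (f : 'rV[int]_m -> 'rV[int]_n) x y : Prop :=
  digital_isomorphism (subimage X (nbhd1 X x)) (subimage Y (nbhd1 Y y)) f.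

Definition local_isomorphism m n (X : digital_image m) (Y : digital_image n)
    (h : 'rV[int]_m -> 'rV[int]_n) : Prop :=
  digital_continuous X Y h /\
  forall x, points X x -> nbhd1_isomorphism X Y h x (h x).

Definition covering_map m n (E : digital_image m) (B : digital_image n)
    (p : 'rV[int]_m -> 'rV[int]_n) : Prop :=
  [/\ digital_continuous E B p,
      set_surj E B p
    & forall b, points B b ->
      exists (M : Type) (e : M -> 'rV[int]_m),
        [/\ forall i, (E `&` p @^-1` [set b]) (e i),
            E `&` p @^-1` (nbhd1 B b) = \bigcup_(i in [set: M]) nbhd1 E (e i),
            forall i j, i <> j -> nbhd1 E (e i) `&` nbhd1 E (e j) = set0
          & forall i, nbhd1_isomorphism E B p (e i) b]].

(* Main.v *)
Require Import Defs.
From mathcomp Require Import all_boot all_algebra.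
From mathcomp Require Import classical_sets functions.
From mathcomp Require Import boolp.

(** A covering map and a local isomorphism both ask [p] to identify
    neighborhoods upstairs with neighborhoods downstairs; they differ in which
    centers are used and in how the sheets fit together.

    If [p] is a covering map and [x] lies over [b], then [x] belongs to some
    sheet around a point [e] over [b].  As [p] is injective on this sheet and
    takes the value [b] at both [x] and [e], the point [x] is the center [e], so
    that the sheet is the neighborhood of [x].

    Conversely, a local isomorphism has the neighborhoods of all points of the
    fiber over [b] as sheets.  Since being a neighbor is symmetric, statements
    about sheets containing [y] become statements about points of the fiber in
    the neighborhood of [y]: surjectivity of [p] from the neighborhood of [y]
    onto that of [p y] puts [y] in some sheet ([local_isomorphism_lift]), and
    injectivity makes this sheet unique ([local_isomorphism_fiber_inj]). *)

Local Open Scope classical_set_scope.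

Lemma nbhd1_sub n (X : digital_image n) x : points X x -> nbhd1 X x `<=` X.
Proof. by move=> Xx y [->|[]]. Qed.

Lemma nbhd1_sym n (X : digital_image n) x y :
  points X x -> nbhd1 X x y -> nbhd1 X y x.
Proof.
move=> Xx [->|[Xy xy]]; first by left.
by right; split=> //; exact: adj_sym xy.
Qed.

Lemma digital_continuous_nbhd1 {m n} {X : digital_image m}
    {Y : digital_image n} {f x y} :
  digital_continuous X Y f -> points X x -> nbhd1 X x y ->
  nbhd1 Y (f x) (f y).
Proof.
move=> [fXY fadj] Xx [->|[Xy /(fadj _ _ Xx Xy)[->|xy]]]; [by left|by left|].
by right; split=> //; exact: fXY.
Qed.

Lemma nbhd1_isomorphism_inj {m n} {X : digital_image m}
    {Y : digital_image n} {f x y u v} :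
  nbhd1_isomorphism X Y f x y -> points X x -> nbhd1 X x u -> nbhd1 X x v ->
  f u = f v -> u = v.
Proof.
move=> [[_ finj _] _ _] Xx xu xv.
by apply: finj; rewrite inE; split=> //; exact: nbhd1_sub Xx _ _.
Qed.

(** Lifting of a path of length one: the edge from [h y] to [b] lifts to an edge
    from [y], as [h] is onto the neighborhood of [h y].  It is read backwards,
    from the end point [x] of the lift, because this is how it places [y] in a
    sheet over [b]. *)
Lemma local_isomorphism_lift {m n} {X : digital_image m}
    {Y : digital_image n} {h y b} :
  local_isomorphism X Y h -> points X y -> points Y b ->
  nbhd1 Y b (h y) -> exists x, [/\ points X x, h x = b & nbhd1 X x y].
Proof.
move=> [_ hiso] Xy Yb bhy; have [[_ _ hsurj] _ _] := hiso y Xy.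
have [|x [Xx yx] hx] := hsurj b.
  by split=> //; exact: nbhd1_sym bhy.
by exists x; split=> //; exact: nbhd1_sym yx.
Qed.

(** Two points of a fiber with a common neighbor [y] both lie in the neighborhood
    of [y], where [h] is injective; hence distinct sheets are disjoint. *)
Lemma local_isomorphism_fiber_inj {m n} {X : digital_image m}
    {Y : digital_image n} {h x x' y} :
  local_isomorphism X Y h -> points X x -> points X x' -> h x = h x' ->
  nbhd1 X x y -> nbhd1 X x' y -> x = x'.
Proof.
move=> [_ hiso] Xx Xx' hxx' xy x'y.
have Xy : points X y by exact: nbhd1_sub Xx _ xy.
by apply: (nbhd1_isomorphism_inj (hiso y Xy) Xy) => //; exact: nbhd1_sym.
Qed.

Lemma covering_map_local_isomorphism {m n} {E : digital_image m}
    {B : digital_image n} {p} :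
  covering_map E B p -> local_isomorphism E B p.
Proof.
move=> [pcont _ pcov]; split=> // x Ex.
have [M [e [efib ecover _ eiso]]] := pcov (p x) (pcont.1 _ Ex).
have [i _ ex] : (\bigcup_(i in [set: M]) nbhd1 E (e i)) x.
  by rewrite -ecover; split=> //; left.
have [Ee pe] := efib i.
suff -> : x = e i by rewrite pe; exact: eiso.
by apply: (nbhd1_isomorphism_inj (eiso i) Ee ex); [left|rewrite pe].
Qed.

Lemma local_isomorphism_covering_map {m n} {E : digital_image m}
    {B : digital_image n} {p} :
  set_surj E B p -> local_isomorphism E B p -> covering_map E B p.
Proof.
move=> psurj piso; have pcont := piso.1; split=> // b Bb.
exists {x | (E `&` p @^-1` [set b]) x}, sval; split.
- by move=> [].
- apply/seteqP; split=> y.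
    move=> [Ey /(local_isomorphism_lift piso Ey Bb)[x [Ex px xy]]].
    by exists (exist _ x (conj Ex px)).
  move=> [[x [Ex px]] _ /= xy]; split; first exact: nbhd1_sub Ex _ xy.
  by rewrite -px; exact: digital_continuous_nbhd1 pcont Ex xy.
- move=> [x [Ex px]] [x' [Ex' px']] neq; apply/seteqP; split=> // y [/= xy x'y].
  apply: neq; apply: eq_exist.
  by apply: local_isomorphism_fiber_inj piso Ex Ex' _ xy x'y; rewrite px px'.
- by move=> [x [Ex px]] /=; rewrite -px; exact: piso.2.
Qed.

Theorem theorem4p2 (m n : nat) (E : digital_image m) (B : digital_image n)
    (p : 'rV[int]_m -> 'rV[int]_n) :
  connected_image E -> connected_image B ->
  digital_continuous E B p -> set_surj E B p ->
  covering_map E B p <-> local_isomorphism E B p.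
Proof.
move=> _ _ _ psurj; split; first exact: covering_map_local_isomorphism.
exact: local_isomorphism_covering_map.
Qed.
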